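(* Let $\mathfrak{C}=\{x\in\mathbb{R}^{d}: f(x)\le 0\}$ and $\mathcal{A}:\mathbb{R}^{d}\to\mathbb{R}^{d}$ satisfy: (A1) $f:\mathbb{R}^{d}\to\mathbb{R}$ is a continuously differentiable convex function and $\nabla f$ is $L_f$-Lipschitz continuous on $\mathbb{R}^{d}$, with $L_f>0$; (A2) $\mathcal{A}$ is pseudo-monotone and $L$-Lipschitz continuous on $\mathfrak{C}$, with $L>0$; (A3) the solution set $VI(\mathfrak{C},\mathcal{A})$ is non-empty; (A4) there exists $\hat{x}\in\mathbb{R}^{d}$ with $f(\hat{x})<0$. Let $\mu,\delta\in(0,1)$, $\sigma>0$, $\gamma\in(0,2)$ and $x_1\in\mathfrak{C}$, and let $\{x_n\}_{n\ge 1}$ be an (infinite) sequence generated by the moving ball algorithm described in the context. Then $\{x_n\}$ converges to a point of $VI(\mathfrak{C},\mathcal{A})$.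
   Context: $\mathbb{R}^d$ carries the Euclidean inner product and norm. $VI(\mathfrak{C},\mathcal{A})$ is the set of solutions of the variational inequality problem (VIP): all $x\in\mathfrak{C}$ such that $\langle \mathcal{A}(x),y-x\rangle\ge 0$ for all $y\in\mathfrak{C}$. $\mathcal{A}$ is pseudo-monotone on $\mathfrak{C}$ if for all $x,y\in\mathfrak{C}$, $\langle\mathcal{A}(x),y-x\rangle\ge 0$ implies $\langle\mathcal{A}(y),y-x\rangle\ge 0$. $P_{D}$ denotes the metric (nearest point) projection onto a non-empty closed convex set $D\subseteq\mathbb{R}^d$. Moving ball: for $x\in\mathbb{R}^d$, $$\mathfrak{B}(x)=\Big\{y\in\mathbb{R}^{d}: f(x)+\langle\nabla f(x),y-x\rangle+\tfrac{L_f}{2}\|y-x\|^2\le 0\Big\}.$$ Under (A1) and (A4), for $x\in\mathfrak{C}$ this is a non-empty closed ball contained in $\mathfrak{C}$. Algorithm (parameters $\mu,\delta\in(0,1)$, $\sigma>0$, $\gamma\in(0,2)$, starting point $x_1\in\mathfrak{C}$). For $n=1,2,\dots$: Step 1. Compute $y_n=P_{\mathfrak{B}(x_n)}(x_n-\lambda_n\mathcal{A}(x_n))$, where $\lambda_n=\sigma\delta^{k_n}$ and $k_n$ is the smallest non-negative integer such that $\lambda_n\|\mathcal{A}(x_n)-\mathcal{A}(y_n)\|\le\mu\|x_n-y_n\|$ (for each trial value of $k_n$, $\lambda_n$ and $y_n$ are those determined by that value). If $x_n=y_n$, stop. Step 2. Otherwise compute $$d_n=x_n-y_n-\lambda_n(\mathcal{A}(x_n)-\mathcal{A}(y_n)),\qquad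 \rho_n=\frac{\langle x_n-y_n,d_n\rangle}{\|d_n\|^2},\qquad x_{n+1}=P_{\mathfrak{B}(x_n)}(x_n-\gamma\lambda_n\rho_n\mathcal{A}(y_n)),$$ and go to Step 1 with $n$ replaced by $n+1$. The sequence is infinite exactly when the algorithm never stops, i.e. $x_n\neq y_n$ for all $n$ (in which case $d_n\ne0$ for all $n$). *)

(* Defs.v *)
From HB Require Import structures.
From mathcomp Require Import all_boot all_order all_algebra.
From mathcomp Require Import all_classical all_reals all_analysis.
Import Order.TTheory GRing.Theory Num.Theory.
Import numFieldNormedType.Exports.

Set Implicit Arguments.
Unset Strict Implicit.
Unset Printing Implicit Defensive.

Local Open Scope classical_set_scope.
Local Open Scope ring_scope.

(* The library norm `|u| on 'rV[R]_d is the sup norm.  It induces the usual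
   topology, so it is harmless in limits and derivatives, but every metric
   notion below (Lipschitz constants, projections, balls) uses [enorm]. *)
Definition dotv (R : realType) (d : nat) (u v : 'rV[R]_d) : R :=
  \sum_(i < d) u ord0 i * v ord0 i.

Definition enorm (R : realType) (d : nat) (u : 'rV[R]_d) : R :=
  Num.sqrt (dotv u u).

Definition elipschitz_on (R : realType) (d : nat) (D : set 'rV[R]_d) (L : R)
    (F : 'rV[R]_d -> 'rV[R]_d) : Prop :=
  forall x y, D x -> D y -> enorm (F x - F y) <= L * enorm (x - y).

Definition grad (R : realType) (d : nat) (f : 'rV[R]_d -> R) (x : 'rV[R]_d) :
    'rV[R]_d :=
  \row_(i < d) 'D_(delta_mx ord0 i) f x.

Definition continuously_differentiable (R : realType) (d : nat)
    (f : 'rV[R]_d -> R) : Prop :=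
  (forall x : 'rV[R]_d, differentiable f x) /\ continuous (grad f).

Definition sublevel0 (R : realType) (d : nat) (f : 'rV[R]_d -> R) :
    set 'rV[R]_d :=
  [set x | f x <= 0].

Definition VI (R : realType) (d : nat) (C : set 'rV[R]_d)
    (A : 'rV[R]_d -> 'rV[R]_d) : set 'rV[R]_d :=
  [set x | C x /\ forall y, C y -> 0 <= dotv (A x) (y - x)].

Definition pseudo_monotone_on (R : realType) (d : nat) (C : set 'rV[R]_d)
    (A : 'rV[R]_d -> 'rV[R]_d) : Prop :=
  forall x y, C x -> C y -> 0 <= dotv (A x) (y - x) -> 0 <= dotv (A y) (y - x).

(* Chosen by [get], hence meaningful only when a nearest point exists; for a
   non-empty closed convex D it exists and is unique. *)
Definition metric_proj (R : realType) (d : nat) (D : set 'rV[R]_d)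
    (z : 'rV[R]_d) : 'rV[R]_d :=
  get [set p | D p /\ forall q, D q -> enorm (z - p) <= enorm (z - q)].

Definition moving_ball (R : realType) (d : nat) (f : 'rV[R]_d -> R) (Lf : R)
    (x : 'rV[R]_d) : set 'rV[R]_d :=
  [set y | f x + dotv (grad f x) (y - x) + Lf / 2 * enorm (y - x) ^+ 2 <= 0].

Section Algorithm.
Context {R : realType} {d : nat}.
Variables (f : 'rV[R]_d -> R) (Lf : R) (A : 'rV[R]_d -> 'rV[R]_d).
Variables (mu delta sigma gamma : R).

Definition step_size (k : nat) : R := sigma * delta ^+ k.

Definition trial_point (x : 'rV[R]_d) (k : nat) : 'rV[R]_d :=
  metric_proj (moving_ball f Lf x) (x - step_size k *: A x).

Definition accepts (x : 'rV[R]_d) (k : nat) : Prop :=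
  step_size k * enorm (A x - A (trial_point x k))
    <= mu * enorm (x - trial_point x k).

Definition line_search (x : 'rV[R]_d) (k : nat) : Prop :=
  accepts x k /\ forall j : nat, accepts x j -> (k <= j)%N.

Definition direction (x y : 'rV[R]_d) (lambda : R) : 'rV[R]_d :=
  x - y - lambda *: (A x - A y).

Definition rho (x y : 'rV[R]_d) (lambda : R) : R :=
  dotv (x - y) (direction x y lambda) / enorm (direction x y lambda) ^+ 2.

Definition next_iterate (x y : 'rV[R]_d) (lambda : R) : 'rV[R]_d :=
  metric_proj (moving_ball f Lf x)
    (x - (gamma * lambda * rho x y lambda) *: A y).

(* An infinite run.  Indices are shifted by one: [x 0] is the starting point
   $x_1$ and [x n] is $x_{n+1}$. *)
Definition moving_ball_run (x1 : 'rV[R]_d) (x : nat -> 'rV[R]_d) : Prop :=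
  x 0%N = x1 /\
  exists (k : nat -> nat) (y : nat -> 'rV[R]_d),
    forall n : nat,
      [/\ line_search (x n) (k n),
          y n = trial_point (x n) (k n),
          x n <> y n &
          x n.+1 = next_iterate (x n) (y n) (step_size (k n))].

End Algorithm.

(* Main.v *)
Require Import Defs.
From mathcomp Require Import all_boot all_order all_algebra.
From mathcomp Require Import all_classical all_reals all_analysis.
From mathcomp Require Import ring lra.
Import Order.TTheory GRing.Theory Num.Theory.
Import numFieldNormedType.Exports.
Local Open Scope classical_set_scope.
Local Open Scope ring_scope.

(* A solution xs need not belong to the moving ball at x_n, so nonexpansiveness
   of the projection does not give Fejer monotonicity directly.  Instead, write
   the projection p of z on the ball {q <= 0}, q the quadratic model of f at
   x_n, in KKT form z - p = nu grad q(p).  Since q(w) <= f(w) + Lf/2 |w - x_n|^2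
   by convexity, every w with f(w) <= 0 satisfies
     <z - p, w - p> <= nu Lf/2 (|w - x_n|^2 - |w - p|^2),
   and the error term has just the shape that can be absorbed:
     (1 + nu Lf) (|x_{n+1} - xs|^2 - |x_n - xs|^2)
       <= - gamma (2 - gamma) rho_n^2 |d_n|^2.
   Slater's condition bounds the multipliers along the (bounded) run, hence
   |x_n - y_n| -> 0.  The same inequality for the projection y_n, divided by
   lambda_n >= min(sigma, mu delta / L), shows that cluster points solve the
   variational inequality, and Fejer monotonicity with respect to one of them
   gives convergence of the whole sequence. *)

(** * Euclidean space *)

Section Euclidean.
Context {R : realType} {d : nat}.
Implicit Types (u v w : 'rV[R]_d) (a : R).

Lemma dotvC u v : dotv u v = dotv v u.
Proof. by apply: eq_bigr => i _; rewrite mulrC. Qed.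

Lemma dotvDl u v w : dotv (u + v) w = dotv u w + dotv v w.
Proof. by rewrite -big_split; apply: eq_bigr => i _; rewrite mxE mulrDl. Qed.

Lemma dotvZl a u v : dotv (a *: u) v = a * dotv u v.
Proof. by rewrite mulr_sumr; apply: eq_bigr => i _; rewrite mxE mulrA. Qed.

Lemma dotvNl u v : dotv (- u) v = - dotv u v.
Proof. by rewrite -scaleN1r dotvZl mulN1r. Qed.

Lemma dotvDr u v w : dotv u (v + w) = dotv u v + dotv u w.
Proof. by rewrite dotvC dotvDl ![dotv _ u]dotvC. Qed.

Lemma dotvZr a u v : dotv u (a *: v) = a * dotv u v.
Proof. by rewrite dotvC dotvZl dotvC. Qed.

Lemma dotvNr u v : dotv u (- v) = - dotv u v.
Proof. by rewrite dotvC dotvNl dotvC. Qed.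

Definition dotvE := (dotvDl, dotvDr, dotvNl, dotvNr, dotvZl, dotvZr).

Lemma dotv_ge0 u : 0 <= dotv u u.
Proof. by apply: sumr_ge0 => i _; rewrite -expr2 sqr_ge0. Qed.

Lemma dotv_eq0 u : dotv u u = 0 -> u = 0.
Proof.
move=> /eqP; rewrite psumr_eq0 => [/allP u0|i _]; last by rewrite -expr2 sqr_ge0.
apply/rowP => i; rewrite mxE.
by have /= := u0 i (mem_index_enum i); rewrite mulf_eq0 orbb => /eqP.
Qed.

Lemma enorm_ge0 u : 0 <= enorm u.
Proof. exact: sqrtr_ge0. Qed.

Lemma sqr_enorm u : enorm u ^+ 2 = dotv u u.
Proof. by rewrite sqr_sqrtr ?dotv_ge0. Qed.

Lemma enorm0 : enorm (0 : 'rV[R]_d) = 0.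
Proof.
by rewrite /enorm -(scale0r 0) dotvZl mul0r sqrtr0.
Qed.

Lemma enorm_eq0 u : enorm u = 0 -> u = 0.
Proof. by move=> u0; apply: dotv_eq0; rewrite -sqr_enorm u0 expr0n. Qed.

Lemma enormN u : enorm (- u) = enorm u.
Proof. by rewrite /enorm dotvNl dotvNr opprK. Qed.

Lemma enormB u v : enorm (u - v) = enorm (v - u).
Proof. by rewrite -enormN opprB. Qed.

Lemma enormZ a u : enorm (a *: u) = `|a| * enorm u.
Proof.
by rewrite /enorm dotvZl dotvZr mulrA -expr2 sqrtrM ?sqr_ge0// sqrtr_sqr.
Qed.

Lemma enorm_le a u : 0 <= a -> dotv u u <= a ^+ 2 -> enorm u <= a.
Proof.
by move=> a0 ua; rewrite -(ler_sqr (enorm_ge0 u)) ?nnegrE// sqr_enorm.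
Qed.

(** Cauchy-Schwarz: for nonzero [u] and [v], expand the squared norm of
    [enorm v *: u - enorm u *: v] and divide by [enorm u * enorm v]. *)
Lemma ler_dotv u v : dotv u v <= enorm u * enorm v.
Proof.
have [u0|u0] := eqVneq (enorm u) 0.
  by rewrite (enorm_eq0 _ u0) -(scale0r 0) dotvZl mul0r enormZ normr0 !mul0r.
have [v0|v0] := eqVneq (enorm v) 0.
  by rewrite (enorm_eq0 _ v0) -(scale0r 0) dotvZr mul0r enormZ normr0 mul0r mulr0.
have u_gt0 : 0 < enorm u by rewrite lt_def u0 enorm_ge0.
have v_gt0 : 0 < enorm v by rewrite lt_def v0 enorm_ge0.
have := dotv_ge0 (enorm v *: u - enorm u *: v).
rewrite !dotvE [dotv v u]dotvC -!sqr_enorm => h.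
rewrite -(ler_pM2l (mulr_gt0 u_gt0 v_gt0)); nra.
Qed.

Lemma ler_dotvN u v : - (enorm u * enorm v) <= dotv u v.
Proof. by have := ler_dotv (- u) v; rewrite enormN dotvNl lerNl. Qed.

Lemma ler_enormD u v : enorm (u + v) <= enorm u + enorm v.
Proof.
apply: enorm_le; first by rewrite addr_ge0 ?enorm_ge0.
rewrite !dotvE [dotv v u]dotvC -!sqr_enorm.
have := ler_dotv u v; nra.
Qed.

Lemma ler_enorm_dist w u v : enorm (u - v) <= enorm (u - w) + enorm (w - v).
Proof. by have := ler_enormD (u - w) (w - v); rewrite addrA subrK. Qed.

End Euclidean.

(** * Comparison of the Euclidean norm with the sup norm *)

Section EuclideanTopology.
Context {R : realType} {d : nat}.
Implicit Types (u v w : 'rV[R]_d) (a : R).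

Lemma norm_le_enorm u : `|u| <= enorm u.
Proof.
rewrite /Num.norm/= mx_normrE; apply/bigmax_leP; split; first exact: enorm_ge0.
move=> [i j] _ /=; rewrite (ord1 i) -(ler_sqr (normr_ge0 _)) ?nnegrE ?enorm_ge0//.
rewrite sqr_enorm /dotv (bigD1 j)//= real_normK ?num_real// expr2 lerDl.
by apply: sumr_ge0 => k _; rewrite -expr2 sqr_ge0.
Qed.

(** The crude constant [d.+1] is positive even for [d = 0], so that it can be divided by. *)
Lemma enorm_le_norm u : enorm u <= d.+1%:R * `|u|.
Proof.
apply: enorm_le => //.
have hi (i : 'I_d) : u ord0 i * u ord0 i <= `|u| ^+ 2.
  rewrite -expr2 -real_normK ?num_real// ler_sqr ?nnegrE//.
  rewrite [leRHS]/Num.norm/= mx_normrE.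
  exact: (le_bigmax _ (fun i => `|u i.1 i.2|) (ord0, i)).
apply: (le_trans (ler_sum _ (fun i _ => hi i))).
rewrite sumr_const card_ord -[_ *+ d]mulr_natl exprMn ler_wpM2r ?sqr_ge0//.
have : 0 <= d%:R :> R by [].
rewrite -natr1; nra.
Qed.

End EuclideanTopology.

(** * Smooth convex functions *)

Section SmoothConvex.
Context {R : realType} {d : nat}.
Implicit Types (f : 'rV[R]_d -> R) (u v w x y : 'rV[R]_d) (t : R).

Lemma derive_grad f x v : differentiable f x -> 'D_v f x = dotv (grad f x) v.
Proof.
move=> df; rewrite deriveE// [in LHS](row_sum_delta v) linear_sum.
by apply: eq_bigr => i _; rewrite linearZ /= mxE -deriveE// mulrC.
Qed.

Lemma is_derive_line f x v t : differentiable f (x + t *: v) ->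
  is_derive t 1 (fun s => f (x + s *: v)) (dotv (grad f (x + t *: v)) v).
Proof.
move=> df; rewrite -derive_grad//.
have E : (fun h : R => h^-1 *: (((fun s => f (x + s *: v)) \o shift t) (h *: 1)
    - f (x + t *: v)))
  = (fun h => h^-1 *: ((f \o shift (x + t *: v)) (h *: v) - f (x + t *: v))).
  apply/funext => h /=; congr (_ *: (f _ - _)).
  by rewrite [h *: 1]mulr1 scalerDl addrCA.
have dv : derivable f (x + t *: v) v by exact: diff_derivable.
by split; rewrite /derivable /derive E.
Qed.

(** By convexity the difference quotients along [y - x] with step in []0, 1]] are at most
    [f y - f x]; let the step tend to 0 from the right. *)
Lemma convex_grad_le f x y : convex_function [set: convex_lmodType 'rV[R]_d] f ->
  differentiable f x -> f x + dotv (grad f x) (y - x) <= f y.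
Proof.
move=> cf df; rewrite -lerBrDl -derive_grad//.
have dv : derivable f x (y - x) by exact: diff_derivable.
have cv := cvg_dnbhs_at_right dv.
rewrite /derive -(cvg_lim _ cv)//.
apply: limr_le; first by apply/cvg_ex; eexists; exact: cv.
near=> h.
have h0 : 0 < h by near: h; exact: nbhs_right_gt.
have h1 : h <= 1 by near: h; exact: nbhs_right_le.
have hI : Itv.spec (@Itv.num_sem R) (Itv.Real `[0%Z, 1%Z]) h.
  by rewrite /= /Itv.num_sem/= in_itv/= num_real ltW.
have fh : f (h *: y + (1 - h) *: x) <= h * f y + (1 - h) * f x.
  exact: (cf (Itv.mk hI) y x (in_setT _) (in_setT _)).
rewrite /= -[_ *: _]/(_ * _) ler_pdivrMl//.
have -> : h *: (y - x) + x = h *: y + (1 - h) *: x.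
  by rewrite scalerBr scalerBl scale1r -addrA [- _ + x]addrC.
apply: le_trans (lerB fh (lexx (f x))) _.
lra.
Unshelve. all: by end_near.
Qed.

(** Mean value theorem for [psi], the gap between [f] and its quadratic model along the segment: the
    Lipschitz gradient and Cauchy-Schwarz make the derivative nonpositive, so [psi 1 <= psi 0]. *)
Lemma descent_lemma f (Lf : R) x y : (forall z, differentiable f z) ->
  elipschitz_on [set: 'rV[R]_d] Lf (grad f) ->
  f y <= f x + dotv (grad f x) (y - x) + Lf / 2 * enorm (y - x) ^+ 2.
Proof.
move=> df lip; have [v vE] : {v | v = y - x} by exists (y - x).
rewrite -vE.
pose psi t := f (x + t *: v)
  - (t * dotv (grad f x) v + t ^+ 2 * (Lf / 2 * enorm v ^+ 2)).
pose dpsi t := dotv (grad f (x + t *: v)) v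
  - (dotv (grad f x) v + t * (Lf * enorm v ^+ 2)).
have dpsiP t : is_derive t 1 psi (dpsi t).
  rewrite /psi.
  have := is_derive_line f x v t (df _) => H.
  apply: is_derive_eq.
  rewrite /dpsi; congr (_ - _); rewrite /=.
  rewrite -![_ *: _ : R]/(_ * _); lra.
have [c|c] := @MVT _ psi dpsi 0 1 ltr01 (fun t _ => dpsiP t).
  exact: derivable_within_continuous.
rewrite in_itv/= => /andP[c0 _].
rewrite subr0 mulr1 => E.
have : dpsi c <= 0.
  have := ler_dotv (grad f (x + c *: v) - grad f x) v.
  have := lip (x + c *: v) x I I.
  rewrite [x + _ - x]addrAC subrr add0r enormZ (gtr0_norm c0) !dotvE /dpsi.
  move=> /(ler_wpM2r (enorm_ge0 v)); lra.
rewrite -E /psi scale1r scale0r addr0 vE [x + _]addrC subrK; lra.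
Qed.

End SmoothConvex.

(** * Projection onto the moving ball *)

Section BallProjection.
Context {R : realType} {d : nat}.
Context (f : 'rV[R]_d -> R) (Lf : R).
Implicit Types (p w x y z : 'rV[R]_d) (nu : R).

(** The moving ball at [x] is by conversion the set where this is at most 0. *)
Definition quad_model x y : R :=
  f x + dotv (grad f x) (y - x) + Lf / 2 * enorm (y - x) ^+ 2.

(** The last vector is the gradient of [quad_model x] at [p]; the third clause is complementary
    slackness. *)
Definition kkt x z p nu : Prop :=
  [/\ 0 <= nu, quad_model x p <= 0, nu * quad_model x p = 0 &
      z - p = nu *: (grad f x + Lf *: (p - x))].

Lemma quad_model_diag x : quad_model x x = f x.
Proof.
by rewrite /quad_model subrr enorm0 -(scale0r 0) dotvZr expr0n mul0r mulr0 !addr0.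
Qed.

(** The second-order expansion at [p] is exact, since the model is quadratic with Hessian [Lf] times
    the identity. *)
Lemma quad_model_taylor x p w :
  dotv (grad f x + Lf *: (p - x)) (w - p) =
    quad_model x w - quad_model x p - Lf / 2 * dotv (w - p) (w - p).
Proof.
rewrite /quad_model !sqr_enorm.
have -> : w - x = (w - p) + (p - x) by rewrite addrA subrK.
move: (w - p) (p - x) => u b; rewrite !dotvE [dotv b u]dotvC; lra.
Qed.

(** Kept as an equality: the quadratic term, dropped in the usual variational inequality, later
    compensates for [w] lying outside the ball. *)
Lemma kkt_variational x z p nu w : kkt x z p nu ->
  dotv (z - p) (w - p) = nu * quad_model x w - nu * (Lf / 2) * dotv (w - p) (w - p).
Proof.
move=> [_ _ nuq ->]; rewrite dotvZl quad_model_taylor 2!mulrBr nuq subr0.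
by ring.
Qed.

Lemma kkt_variational_le0 x z p nu w : 0 <= Lf -> kkt x z p nu ->
  quad_model x w <= 0 -> dotv (z - p) (w - p) <= 0.
Proof.
move=> Lf0 h qw; rewrite (kkt_variational _ _ _ _ w h).
have [nu0 _ _ _] := h.
have := mulr_ge0_le0 nu0 qw.
by have := mulr_ge0 (mulr_ge0 nu0 Lf0) (dotv_ge0 (w - p)); lra.
Qed.

(** A point [z] of the ball is its own projection, with multiplier 0. Otherwise the projection onto
    a ball of positive radius is explicit. *)
Lemma kkt_exists x z w : 0 < Lf -> quad_model x w < 0 ->
  exists p nu, kkt x z p nu.
Proof.
move=> Lf0 qw.
have [qz|qz] := leP (quad_model x z) 0.
  by exists z, 0; split; rewrite ?subrr ?mul0r ?scale0r.
have Lfn : Lf != 0 by rewrite gt_eqF.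
(* Completing the square: the ball has centre [c] and squared radius [2 * s / Lf], which is positive
   because [w] lies strictly inside. *)
pose c := x - Lf^-1 *: grad f x.
pose s := dotv (grad f x) (grad f x) / Lf / 2 - f x.
have qE y : quad_model x y = Lf / 2 * dotv (y - c) (y - c) - s.
  rewrite /quad_model /c /s sqr_enorm opprB addrCA [_ + (y - x)]addrC.
  move: (y - x) (grad f x) => v g.
  by rewrite !dotvE [dotv g v]dotvC; field.
have s_gt0 : 0 < s.
  have := mulr_ge0 (ltW Lf0) (dotv_ge0 (w - c)).
  by move: qw; rewrite qE; lra.
pose r := Num.sqrt (2 * s / Lf); pose m := enorm (z - c).
have r2 : r ^+ 2 = 2 * s / Lf.
  by rewrite sqr_sqrtr// divr_ge0 ?(ltW Lf0)// mulr_ge0// ltW.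
have r_gt0 : 0 < r by rewrite sqrtr_gt0 divr_gt0// mulr_gt0.
have rm : r < m.
  rewrite -ltr_sqr ?nnegrE ?enorm_ge0 ?ltW// r2 sqr_enorm ltr_pdivrMr//.
  by move: qz; rewrite qE; lra.
have m_gt0 : 0 < m by exact: lt_trans rm.
have mn : m != 0 by rewrite gt_eqF.
have rn : r != 0 by rewrite gt_eqF.
have pc : c + (r / m) *: (z - c) - c = (r / m) *: (z - c).
  by rewrite addrAC subrr add0r.
have qp : quad_model x (c + (r / m) *: (z - c)) = 0.
  rewrite qE pc dotvZl dotvZr -sqr_enorm -/m.
  suff -> : Lf / 2 * (r / m * (r / m * m ^+ 2)) = Lf / 2 * r ^+ 2.
    by rewrite r2; field.
  by field.
(* [grad q(y) = Lf (y - c)] and the projection is radial. *)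
exists (c + (r / m) *: (z - c)), ((m - r) / (r * Lf)); split.
- by rewrite divr_ge0 ?subr_ge0 ?mulr_ge0 ?ltW.
- by rewrite qp.
- by rewrite qp mulr0.
have -> : grad f x + Lf *: (c + (r / m) *: (z - c) - x)
    = Lf *: (c + (r / m) *: (z - c) - c).
  rewrite /c; move: ((r / m) *: _) => b.
  apply/rowP => i; rewrite !mxE; by field.
rewrite pc !scalerA opprD addrA -[X in X - _](scale1r (z - c)) -scalerBl.
suff -> : (m - r) / (r * Lf) * Lf * (r / m) = 1 - r / m by [].
field; by apply/and3P; split.
Qed.

(** [metric_proj] picks some nearest point; [far] shows that the KKT point is nearest and that any
    other nearest point is at distance 0 from it. *)
Lemma kkt_metric_proj x z w : 0 < Lf -> quad_model x w < 0 ->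
  exists nu, kkt x z (metric_proj (moving_ball f Lf x) z) nu.
Proof.
move=> Lf0 qw; have [p [nu h]] := kkt_exists x z w Lf0 qw.
have [_ qp _ _] := h.
have far q : quad_model x q <= 0 ->
    dotv (z - p) (z - p) + dotv (p - q) (p - q) <= dotv (z - q) (z - q).
  move=> /(kkt_variational_le0 _ _ _ _ _ (ltW Lf0) h).
  have -> : z - q = (z - p) + (p - q) by rewrite addrA subrK.
  rewrite -[q - p]opprB; move: (z - p) (p - q) => u v.
  by rewrite !dotvE [dotv v u]dotvC; lra.
suff <- : p = metric_proj (moving_ball f Lf x) z by exists nu.
rewrite /metric_proj; set D := (X in get X).
have [|qP /(_ p qp)] := @getPex _ D.
  exists p; split=> // q /far qq.
  apply: enorm_le; first exact: enorm_ge0.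
  by rewrite sqr_enorm; have := dotv_ge0 (p - q); lra.
rewrite -ler_sqr ?nnegrE ?enorm_ge0// !sqr_enorm => le_zP.
apply/eqP; rewrite -subr_eq0; apply/eqP; apply: dotv_eq0.
have /= := far _ qP; have := dotv_ge0 (p - get D).
by move=> h1 h2; lra.
Qed.

(** Since [f x <= 0], the point [x] is in the ball, so the triangle [z], [p], [x] has a right or
    obtuse angle at [p]: both legs are at most the opposite side. *)
Lemma kkt_dist x z p nu : 0 <= Lf -> f x <= 0 -> kkt x z p nu ->
  enorm (p - x) <= enorm (z - x) /\ enorm (z - p) <= enorm (z - x).
Proof.
move=> Lf0 fx h.
have := kkt_variational_le0 _ _ _ _ x Lf0 h.
rewrite quad_model_diag => /(_ fx).
have -> : z - x = (z - p) + (p - x) by rewrite addrA subrK.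
rewrite -[x - p]opprB; move: (z - p) (p - x) => u v uv.
have := dotv_ge0 u; have := dotv_ge0 v => hv hu.
by split; (apply: enorm_le; first exact: enorm_ge0);
  rewrite sqr_enorm; move: uv; rewrite !dotvE [dotv v u]dotvC; lra.
Qed.

End BallProjection.

(** * One step of the algorithm *)

Section MovingBallStep.
Context {R : realType} {d : nat}.
Context (f : 'rV[R]_d -> R) (A : 'rV[R]_d -> 'rV[R]_d) (Lf : R).
Context (df : forall x, differentiable f x).
Context (f_convex : convex_function [set: convex_lmodType 'rV[R]_d] f).
Context (Lf_gt0 : 0 < Lf).
Context (grad_lip : elipschitz_on [set: 'rV[R]_d] Lf (grad f)).
Implicit Types (p w x y z : 'rV[R]_d) (nu : R).

Lemma moving_ball_sub x y : quad_model f Lf x y <= 0 -> f y <= 0.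
Proof. exact: le_trans (descent_lemma _ _ _ _ df grad_lip). Qed.

Lemma quad_model_le x w :
  f w <= 0 -> quad_model f Lf x w <= Lf / 2 * dotv (w - x) (w - x).
Proof.
have := convex_grad_le f x w f_convex (df x).
by rewrite /quad_model sqr_enorm; lra.
Qed.

Lemma kkt_variational_sublevel x z p nu w : kkt f Lf x z p nu -> f w <= 0 ->
  dotv (z - p) (w - p) <=
    nu * (Lf / 2) * (dotv (w - x) (w - x) - dotv (w - p) (w - p)).
Proof.
move=> h fw; rewrite (kkt_variational _ _ _ _ _ _ w h).
have [nu0 _ _ _] := h.
by have := ler_wpM2l nu0 (quad_model_le x w fw); lra.
Qed.

(** A depth below 0 that depends on [x] only through the bound [M], hence is uniform along a bounded
    run. *)
Definition slater_gap (eps M : R) : R := eps ^+ 2 / (eps + Lf * M ^+ 2) / 2.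

Lemma slater_gap_gt0 (eps M : R) : 0 < eps -> 0 < slater_gap eps M.
Proof.
move=> e0; rewrite !divr_gt0// ?exprn_gt0//.
by rewrite ltr_pwDl// mulr_ge0// ?sqr_ge0// ltW.
Qed.

(* The witness is [x + s (xh - x)] with [s = eps / (eps + Lf M^2)], which makes
   the quadratic term at most half of the linear decrease [s eps]. *)
Lemma quad_model_slater x xh (eps M : R) : f x <= 0 -> 0 < eps ->
  f xh <= - eps -> enorm (xh - x) <= M ->
  exists2 w, quad_model f Lf x w <= - slater_gap eps M & enorm (w - x) <= M.
Proof.
move=> fx e0 fxh xhM; pose q := eps + Lf * M ^+ 2.
have q0 : 0 < q by rewrite ltr_pwDl// mulr_ge0// ?sqr_ge0// ltW.
have M0 : 0 <= M by exact: le_trans (enorm_ge0 _) xhM.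
have M2 : enorm (xh - x) ^+ 2 <= M ^+ 2 by rewrite ler_sqr ?nnegrE ?enorm_ge0.
have g := convex_grad_le f x xh f_convex (df x).
have s0 : 0 < eps / q by rewrite divr_gt0.
have s1 : eps / q <= 1.
  by rewrite ler_pdivrMr// mul1r lerDl mulr_ge0// ?sqr_ge0// ltW.
exists (x + (eps / q) *: (xh - x)); rewrite /quad_model [x + _ - x]addrAC subrr add0r.
  have -> : slater_gap eps M = eps / q * (eps / 2).
    by rewrite /slater_gap -/q; field; rewrite gt_eqF.
  have sq : eps / q * (Lf * M ^+ 2) = eps - eps / q * eps.
    by rewrite /q; field; rewrite gt_eqF.
  rewrite dotvZr enormZ (gtr0_norm s0) exprMn.
  move: (eps / q) s0 s1 sq => s s0 s1 sq.
  (* The affine part at the witness is [(1 - s) * f x] plus [s] times the linearization at [xh], so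
     [h1] and [h2] bound it by [- s * eps]; [h3] and [h4] bound the quadratic part by
     [s * eps / 2]. *)
  have h1 : 0 <= s * (- eps - (f x + dotv (grad f x) (xh - x))).
    by apply: mulr_ge0; [exact: ltW | lra].
  have h2 : 0 <= (1 - s) * - f x by apply: mulr_ge0; lra.
  have h3 : 0 <= s ^+ 2 * (Lf * (M ^+ 2 - enorm (xh - x) ^+ 2)).
    by rewrite mulr_ge0 ?sqr_ge0// mulr_ge0 ?subr_ge0// ltW.
  have h4 : s * (s * (Lf * M ^+ 2)) <= s * eps.
    rewrite sq ler_wpM2l ?(ltW s0)//.
    by have := mulr_gt0 s0 e0; lra.
  move: h1 h2 h3 h4; lra.
rewrite enormZ (gtr0_norm s0); apply: le_trans xhM.
by rewrite ler_piMl ?enorm_ge0.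
Qed.

(** Test [kkt_variational] at the deep point [w]: [nu * slater_gap eps M] is at most
    [enorm (z - p) * enorm (w - p)]. *)
Lemma kkt_multiplier_le x z p nu xh (eps M T : R) : kkt f Lf x z p nu ->
  f x <= 0 -> 0 < eps -> f xh <= - eps -> enorm (xh - x) <= M ->
  enorm (z - x) <= T -> nu <= T * (M + T) / slater_gap eps M.
Proof.
move=> h fx e0 fxh xhM zT.
have [w qw wM] := quad_model_slater x xh eps M fx e0 fxh xhM.
rewrite ler_pdivlMr ?slater_gap_gt0//.
have [px zp] := kkt_dist _ _ _ _ _ _ (ltW Lf_gt0) fx h.
have [nu0 _ _ _] := h.
have := kkt_variational _ _ _ _ _ _ w h.
have := ler_dotvN (z - p) (w - p) => cs kv.
have wp : enorm (w - p) <= M + T.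
  have := ler_enorm_dist x w p; rewrite (enormB x p); lra.
have b : enorm (z - p) * enorm (w - p) <= T * (M + T).
  by rewrite ler_pM ?enorm_ge0//; exact: le_trans zT.
have := ler_wpM2l nu0 qw.
have := mulr_ge0 (mulr_ge0 nu0 (ltW Lf_gt0)) (dotv_ge0 (w - p)).
by lra.
Qed.

Lemma direction_dotv_ge x y (mu lam : R) : 0 <= lam ->
  lam * enorm (A x - A y) <= mu * enorm (x - y) ->
  (1 - mu) * enorm (x - y) ^+ 2 <= dotv (x - y) (direction A x y lam).
Proof.
move=> lam0 h; rewrite /direction dotvDr dotvNr -sqr_enorm.
have := ler_dotv (x - y) (lam *: (A x - A y)).
rewrite enormZ (ger0_norm lam0).
by have := ler_wpM2l (enorm_ge0 (x - y)) h; lra.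
Qed.

Lemma enorm_direction_le x y (mu lam : R) : 0 <= lam ->
  lam * enorm (A x - A y) <= mu * enorm (x - y) ->
  enorm (direction A x y lam) <= (1 + mu) * enorm (x - y).
Proof.
move=> lam0 h; apply: le_trans (ler_enormD _ _) _.
by rewrite enormN enormZ (ger0_norm lam0); lra.
Qed.

Lemma enorm_direction_gt0 x y (mu lam : R) : 0 <= lam -> mu < 1 -> x <> y ->
  lam * enorm (A x - A y) <= mu * enorm (x - y) ->
  0 < enorm (direction A x y lam).
Proof.
move=> lam0 mu1 xy h.
have e0 : 0 < enorm (x - y).
  rewrite lt_def enorm_ge0 andbT; apply/eqP => /enorm_eq0/eqP.
  by rewrite subr_eq0 => /eqP.
have := direction_dotv_ge x y mu lam lam0 h.
have := ler_dotv (x - y) (direction A x y lam).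
rewrite lt_def enorm_ge0 andbT; case: eqP => // ->; rewrite mulr0.
by have := mulr_gt0 (_ : 0 < 1 - mu) (exprn_gt0 2 e0); lra.
Qed.

(** The upper bound controls the length of the second step; the last estimate turns the Fejer
    decrease into a multiple of the squared residual. *)
Lemma rho_bounds x y (mu lam : R) : 0 <= lam -> 0 < mu < 1 -> x <> y ->
  lam * enorm (A x - A y) <= mu * enorm (x - y) ->
  [/\ 0 <= rho A x y lam, rho A x y lam <= (1 - mu)^-1 &
      ((1 - mu) / (1 + mu)) ^+ 2 * enorm (x - y) ^+ 2 <=
        rho A x y lam ^+ 2 * enorm (direction A x y lam) ^+ 2].
Proof.
move=> lam0 /andP[mu0 mu1] xy h.
have n0 := enorm_direction_gt0 x y mu lam lam0 mu1 xy h.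
have dle := enorm_direction_le x y mu lam lam0 h.
have Dge := direction_dotv_ge x y mu lam lam0 h.
have Dle := ler_dotv (x - y) (direction A x y lam).
rewrite /rho; move: (direction A x y lam) n0 dle Dge Dle => v n0 dle Dge Dle.
have e0 := enorm_ge0 (x - y).
move: (enorm (x - y)) (enorm v) (dotv (x - y) v) e0 n0 dle Dge Dle.
move=> e n D e0 n0 dle Dge Dle.
have mu1' : 0 < 1 - mu by lra.
have D0 : 0 <= D by apply: le_trans Dge; rewrite mulr_ge0 ?sqr_ge0// ltW.
have nn : n != 0 by rewrite gt_eqF.
have e_gt0 : 0 < e.
  by rewrite lt_def e0 andbT; apply/eqP => ee; move: dle; rewrite ee; lra.
(* From [(1 - mu) * e ^+ 2 <= D <= e * n], divided by [e]. *)
have en : (1 - mu) * e <= n.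
  by rewrite -(ler_pM2l e_gt0); apply: le_trans Dle; apply: le_trans Dge; lra.
split.
- by rewrite divr_ge0 ?sqr_ge0.
- rewrite ler_pdivrMr ?exprn_gt0// ler_pdivlMl//.
  by apply: le_trans (_ : (1 - mu) * (e * n) <= _); rewrite ?ler_pM2l//
    mulrA expr2 ler_wpM2r// ltW.
- have -> : (D / n ^+ 2) ^+ 2 * n ^+ 2 = (D / n) ^+ 2 by field.
  have mu2 : 0 < 1 + mu by lra.
  have c0 : 0 <= (1 - mu) / (1 + mu) * e by rewrite mulr_ge0// divr_ge0// ltW.
  rewrite -exprMn ler_sqr ?nnegrE ?divr_ge0 ?(ltW n0)//.
  rewrite ler_pdivlMr// -mulrA mulrAC ler_pdivrMr//.
  have := ler_wpM2l (mulr_ge0 (ltW mu1') e0) dle.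
  by have := ler_wpM2l (ltW mu2) Dge; lra.
Qed.

(** Combines pseudo-monotonicity at [y] ([pm]), the projection inequality for [y] tested at [p],
    which is in the same ball ([vy]), and the inequality with error term for [p] tested at [xs]
    ([vp]). *)
Lemma fejer_step x y p xs (nu nuy mu gamma lam : R) :
  VI (sublevel0 f) A xs -> pseudo_monotone_on (sublevel0 f) A ->
  0 < lam -> 0 < gamma -> 0 < mu < 1 -> x <> y ->
  lam * enorm (A x - A y) <= mu * enorm (x - y) ->
  kkt f Lf x (x - lam *: A x) y nuy ->
  kkt f Lf x (x - (gamma * lam * rho A x y lam) *: A y) p nu ->
  (1 + nu * Lf) * (enorm (p - xs) ^+ 2 - enorm (x - xs) ^+ 2) <=
    - (gamma * (2 - gamma) *
       (rho A x y lam ^+ 2 * enorm (direction A x y lam) ^+ 2)).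
Proof.
move=> [xsC xsVI] A_pm lam0 gamma0 mu01 xy h ky kp.
have [rho0 _ _] := rho_bounds x y mu lam (ltW lam0) mu01 xy h.
have /andP[_ mu1] := mu01.
have n0 := enorm_direction_gt0 x y mu lam (ltW lam0) mu1 xy h.
have rhoE : dotv (x - y) (direction A x y lam)
    = rho A x y lam * enorm (direction A x y lam) ^+ 2.
  by rewrite /rho divfK// gt_eqF// exprn_gt0.
have qy : quad_model f Lf x y <= 0 by case: ky.
have qp : quad_model f Lf x p <= 0 by case: kp.
have yC := moving_ball_sub _ _ qy.
have pm := A_pm _ _ xsC yC (xsVI _ yC).
have vy := kkt_variational_le0 _ _ _ _ _ _ p (ltW Lf_gt0) ky qp.
have vp := kkt_variational_sublevel _ _ _ _ _ kp xsC.
move: (rho A x y lam) rho0 rhoE kp vp => r r0 rE kp vp.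
(* Thus [vy] bounds [lam * dotv (A y) (p - y)] from below by the inner product of the direction with
   [p - y]. *)
have eD : x - lam *: A x - y = direction A x y lam - lam *: A y.
  rewrite /direction; move: (A x) (A y) => a b.
  by apply/rowP => i; rewrite !mxE; ring.
move: vy; rewrite eD.
move: (direction A x y lam) n0 rE => D n0 rE vy.
rewrite !sqr_enorm in rE vp |- *.
have e1 : y - xs = - (x - y) - (xs - x) by apply/rowP => i; rewrite !mxE; ring.
have e2 : p - y = (p - x) + (x - y) by rewrite addrA subrK.
have e3 : xs - p = (xs - x) - (p - x) by apply/rowP => i; rewrite !mxE; ring.
have e4 : x - (gamma * lam * r) *: A y - p = - (p - x) - (gamma * lam * r) *: A y.
  by apply/rowP => i; rewrite !mxE; ring.
have e5 : p - xs = (p - x) - (xs - x) by apply/rowP => i; rewrite !mxE; ring.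
have e6 : x - xs = - (xs - x) by rewrite opprB.
rewrite e1 in pm; rewrite e2 in vy; rewrite e3 e4 in vp.
rewrite e5 e6.
move: (A y) (x - y) (p - x) (xs - x) pm vy vp rE => a e b w pm vy vp rE.
(* This square absorbs the cross term between [p - x] and the direction, turning the factor
   [2 * gamma] into [gamma * (2 - gamma)]. *)
have sq := dotv_ge0 (b + (gamma * r) *: D).
move: pm vy vp rE sq; rewrite !dotvE.
rewrite [dotv e D]dotvC [dotv w b]dotvC [dotv b D]dotvC.
move=> pm vy vp rE sq.
have gr0 : 0 <= gamma * r by rewrite mulr_ge0// ltW.
have h1 := ler_wpM2l gr0 vy.
have h2 := mulr_ge0 (mulr_ge0 gr0 (ltW lam0)) pm.
nra.
Qed.

(** With [w - y] split as [(w - x) + (x - y)], the error term for [w] loses its [w - x] square, so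
    all errors are controlled by [enorm (x - y)]. *)
Lemma kkt_vi_gap x y w (nu lam : R) : 0 < lam ->
  kkt f Lf x (x - lam *: A x) y nu -> f w <= 0 ->
  - (enorm (x - y) * ((1 + nu * Lf) * enorm (w - x) + lam * enorm (A x))) <=
    lam * dotv (A x) (w - x).
Proof.
move=> lam0 ky fw.
have vy := kkt_variational_sublevel _ _ _ _ _ ky fw.
have [nu0 _ _ _] := ky.
have e1 : w - y = (w - x) + (x - y) by rewrite addrA subrK.
rewrite e1 [x - _ - y]addrAC in vy.
move: (A x) (x - y) (w - x) vy => a e v vy.
have c1 := ler_dotvN e v.
have c2 := ler_dotv a e.
have ee := dotv_ge0 e.
move: vy; rewrite !dotvE [dotv v e]dotvC => vy.
have n1 := mulr_ge0 nu0 (ltW Lf_gt0).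
have h1 := ler_wpM2l n1 c1.
have h2 := mulr_ge0 n1 ee.
have h3 := ler_wpM2l (ltW lam0) c2.
lra.
Qed.

End MovingBallStep.

(** * Convergence of the run *)

(** [a] is nonincreasing and bounded below, hence convergent; its consecutive differences dominate
    [b] and tend to 0. *)
Lemma cvg_decrement0 (R : realType) (a b : nat -> R) :
  (forall n, 0 <= a n) -> (forall n, 0 <= b n) ->
  (forall n, a n.+1 <= a n - b n) -> b n @[n --> \oo] --> 0.
Proof.
move=> a0 b0 ab.
have a_cvg : cvgn a.
  apply: nonincreasing_is_cvgn; last by exists 0 => _ [n _ <-].
  by apply/nonincreasing_seqP => n; apply: le_trans (ab n) _; rewrite gerBl.
have d_cvg : (a n - a n.+1) @[n --> \oo] --> 0.
  rewrite -(subrr (limn a)); apply: cvgB => //.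
  by have := a_cvg; rewrite -(cvg_shiftS a).
apply: (squeeze_cvgr _ (cvg_cst 0) d_cvg).
by near=> n; rewrite b0/=; have := ab n; lra.
Unshelve. all: by end_near.
Qed.

(** Bolzano-Weierstrass, through compactness of closed sup-norm balls. *)
Lemma bounded_seq_cluster (R : realType) (d : nat) (x : nat -> 'rV[R]_d) (M : R) :
  (forall n, enorm (x n) <= M) ->
  exists p, forall e N, 0 < e -> exists2 n, (N <= n)%N & enorm (x n - p) < e.
Proof.
move=> xM; pose K := [set u : 'rV[R]_d | `|u| <= M].
have Kc : compact K.
  apply: bounded_closed_compact.
    by exists M; split; rewrite ?num_real// => r /ltW Mr u /le_trans; apply.
  apply: (@closed_comp _ _ (fun u : 'rV[R]_d => `|u|) [set r | r <= M]).
    by move=> u _; exact: norm_continuous.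
  exact: closed_le.
have [|p [_ px]] := Kc (x n @[n --> \oo]) _ _.
  suff : \forall n \near \oo, K (x n) by [].
  by apply: nearW => n; exact: le_trans (norm_le_enorm _) (xM n).
exists p => e N e0.
pose e' := e / d.+1%:R.
have e'0 : 0 < e' by rewrite divr_gt0.
have [|_ [[n Nn <-]]] :=
  px [set x n | n in [set n | (N <= n)%N]] _ _ (nbhsx_ballx p e' e'0).
  suff : \forall n \near \oo, [set x n | n in [set n | (N <= n)%N]] (x n) by [].
  by near=> n; exists n => //=; near: n; exact: nbhs_infty_ge.
rewrite -ball_normE/= => pn; exists n => //.
apply: le_lt_trans (enorm_le_norm _) _.
by rewrite distrC mulrC -ltr_pdivlMr.
Unshelve. all: by end_near.
Qed.

Lemma enorm_cvg (R : realType) (d : nat) (x : nat -> 'rV[R]_d) (p : 'rV[R]_d) :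
  (forall e, 0 < e -> exists N, forall n, (N <= n)%N -> enorm (x n - p) < e) ->
  x n @[n --> \oo] --> p.
Proof.
move=> h; apply/cvgrPdist_lt => e /h[N Nh].
near=> n; rewrite distrC; apply: le_lt_trans (norm_le_enorm _) (Nh _ _).
by near: n; exact: nbhs_infty_ge.
Unshelve. all: by end_near.
Qed.

(** * Lower bound on the accepted step sizes *)

Section LineSearch.
Context {R : realType} {d : nat}.
Context (f : 'rV[R]_d -> R) (A : 'rV[R]_d -> 'rV[R]_d) (Lf L : R).
Context (mu delta sigma : R).

Lemma step_size_gt0 k : 0 < sigma -> 0 < delta -> 0 < step_size delta sigma k.
Proof. by move=> s0 d0; rewrite mulr_gt0// exprn_gt0. Qed.

Lemma step_size_le k : 0 < sigma -> 0 < delta < 1 -> step_size delta sigma k <= sigma.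
Proof.
by move=> s0 /andP[d0 d1]; rewrite ler_piMr ?(ltW s0)// exprn_ile1 ?ltW.
Qed.

Lemma line_search_step_ge x k : 0 < sigma -> 0 < delta < 1 -> 0 < L ->
  elipschitz_on (sublevel0 f) L A -> sublevel0 f x ->
  (forall j, sublevel0 f (trial_point f Lf A delta sigma x j)) ->
  line_search f Lf A mu delta sigma x k ->
  Num.min sigma (mu * delta / L) <= step_size delta sigma k.
Proof.
move=> s0 /andP[d0 d1] L0 A_lip xC yC [_ kmin]; rewrite ge_min.
case: k kmin => [|k] kmin; first by rewrite /step_size expr0 mulr1 lexx.
apply/orP; right; rewrite ler_pdivrMr//.
(* By minimality the previous, larger step was rejected; with the Lipschitz bound this forces [mu]
   to be below that step times [L]. *)
have /negP : ~ accepts f Lf A mu delta sigma x k by move/kmin; rewrite ltnn.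
rewrite -ltNge => hk.
have lipk := A_lip _ _ xC (yC k).
have l0 := step_size_gt0 k s0 d0.
have e0 := enorm_ge0 (x - trial_point f Lf A delta sigma x k).
have h := lt_le_trans hk (ler_wpM2l (ltW l0) lipk).
(* Rejection is strict, so the trial point differs from [x] and the distance cancels. *)
have e1 : 0 < enorm (x - trial_point f Lf A delta sigma x k).
  by rewrite lt_def e0 andbT; apply/eqP => ee; move: h; rewrite ee !mulr0 ltxx.
move: h; rewrite mulrA ltr_pM2r// => /ltW h.
have := ler_wpM2r (ltW d0) h.
by rewrite {2}/step_size exprS /step_size; lra.
Qed.

End LineSearch.

(** * Feasibility and Fejer monotonicity of the run *)

Section Run.
Context {R : realType} {d : nat}.
Context (f : 'rV[R]_d -> R) (A : 'rV[R]_d -> 'rV[R]_d) (Lf L : R).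
Context (df : forall x, differentiable f x).
Context (f_convex : convex_function [set: convex_lmodType 'rV[R]_d] f).
Context (Lf_gt0 : 0 < Lf).
Context (grad_lip : elipschitz_on [set: 'rV[R]_d] Lf (grad f)).
Context (A_pm : pseudo_monotone_on (sublevel0 f) A).
Context (L_gt0 : 0 < L) (A_lip : elipschitz_on (sublevel0 f) L A).
Context (xh : 'rV[R]_d) (fxh : f xh < 0).
Context (mu delta sigma gamma : R).
Context (mu01 : 0 < mu < 1) (delta01 : 0 < delta < 1).
Context (sigma_gt0 : 0 < sigma) (gamma02 : 0 < gamma < 2).
Context (x y : nat -> 'rV[R]_d) (k : nat -> nat).
Context (x0C : sublevel0 f (x 0%N)).
Context (run : forall n, [/\ line_search f Lf A mu delta sigma (x n) (k n),
  y n = trial_point f Lf A delta sigma (x n) (k n), x n <> y n &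
  x n.+1 = next_iterate f Lf A gamma (x n) (y n) (step_size delta sigma (k n))]).

Local Notation lam n := (step_size delta sigma (k n)).

(** Slater's condition puts a strictly interior point in every moving ball centred on a feasible
    [u]. *)
Lemma kkt_moving_ball u z : sublevel0 f u ->
  exists nu, kkt f Lf u z (metric_proj (moving_ball f Lf u) z) nu.
Proof.
move=> uC.
(* The Slater margin is [eps = - f xh]. *)
have e0 : 0 < - f xh by rewrite oppr_gt0.
have [|w qw _] := quad_model_slater _ _ df f_convex Lf_gt0 _ xh _
  (enorm (xh - u)) uC e0 _ (lexx _).
  by rewrite opprK.
apply: (kkt_metric_proj _ _ _ _ w) => //; apply: le_lt_trans qw _.
by rewrite oppr_lt0 slater_gap_gt0.
Qed.

Lemma metric_proj_moving_ball_sublevel u z : sublevel0 f u ->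
  sublevel0 f (metric_proj (moving_ball f Lf u) z).
Proof.
move=> /(kkt_moving_ball u z)[nu [_ q _ _]].
exact: moving_ball_sub df grad_lip _ _ q.
Qed.

Lemma iterate_sublevel n : sublevel0 f (x n).
Proof.
elim: n => // n xC; have [_ _ _ ->] := run n.
exact: metric_proj_moving_ball_sublevel.
Qed.

Lemma trial_sublevel n : sublevel0 f (y n).
Proof.
have [_ -> _ _] := run n.
exact/metric_proj_moving_ball_sublevel/iterate_sublevel.
Qed.

Lemma lam_gt0 n : 0 < lam n.
Proof. by case/andP: delta01 => d0 _; exact: step_size_gt0. Qed.

Lemma lam_ge n : Num.min sigma (mu * delta / L) <= lam n.
Proof.
have [ls _ _ _] := run n.
apply: (line_search_step_ge f A Lf L mu delta sigma (x n)) => //.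
  exact: iterate_sublevel.
by move=> j; exact/metric_proj_moving_ball_sublevel/iterate_sublevel.
Qed.

Lemma lam_accepts n : lam n * enorm (A (x n) - A (y n)) <= mu * enorm (x n - y n).
Proof. by have [[acc _] -> _ _] := run n. Qed.

Lemma kkt_y n : exists nu, kkt f Lf (x n) (x n - lam n *: A (x n)) (y n) nu.
Proof. by have [_ -> _ _] := run n; exact/kkt_moving_ball/iterate_sublevel. Qed.

Lemma kkt_x n : exists nu, kkt f Lf (x n)
  (x n - (gamma * lam n * rho A (x n) (y n) (lam n)) *: A (y n)) (x n.+1) nu.
Proof. by have [_ _ _ ->] := run n; exact/kkt_moving_ball/iterate_sublevel. Qed.

Lemma fejer_run xs n nu : VI (sublevel0 f) A xs ->
  kkt f Lf (x n) (x n - (gamma * lam n * rho A (x n) (y n) (lam n)) *: A (y n))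
    (x n.+1) nu ->
  (1 + nu * Lf) * (enorm (x n.+1 - xs) ^+ 2 - enorm (x n - xs) ^+ 2) <=
    - (gamma * (2 - gamma) * ((1 - mu) / (1 + mu)) ^+ 2 * enorm (x n - y n) ^+ 2).
Proof.
move=> xsVI kp; have [nuy ky] := kkt_y n.
have [_ _ xy _] := run n.
have /andP[g0 g2] := gamma02.
apply: le_trans (fejer_step _ _ _ df f_convex Lf_gt0 grad_lip _ _ _ _ _ _ _ _ _
  xsVI A_pm (lam_gt0 n) g0 mu01 xy (lam_accepts n) ky kp) _.
rewrite lerN2 -[leLHS]mulrA ler_wpM2l//; first by apply: mulr_ge0; lra.
by have [] := rho_bounds A _ _ _ _ (ltW (lam_gt0 n)) mu01 xy (lam_accepts n).
Qed.

Lemma fejer_monotone xs : VI (sublevel0 f) A xs ->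
  {homo (fun n => enorm (x n - xs)) : m n / (m <= n)%N >-> n <= m}.
Proof.
move=> xsVI; apply/nonincreasing_seqP => n.
have [nu kp] := kkt_x n.
have h := fejer_run _ _ _ xsVI kp.
rewrite -ler_sqr ?nnegrE ?enorm_ge0// -subr_le0.
have [nu0 _ _ _] := kp.
have Q0 : 0 < 1 + nu * Lf by rewrite ltr_pwDl// mulr_ge0// ltW.
rewrite -(pmulr_rle0 _ Q0); apply: le_trans h _.
rewrite oppr_le0 mulr_ge0 ?sqr_ge0// mulr_ge0 ?sqr_ge0//.
by case/andP: gamma02 => *; apply: mulr_ge0; lra.
Qed.

(** * Uniform bounds, vanishing residual and cluster points *)

Section Bounds.
Context (xs : 'rV[R]_d) (xsVI : VI (sublevel0 f) A xs).

Definition A_bound := enorm (A xs) + L * enorm (x 0%N - xs).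

Lemma enorm_Ax_le n : enorm (A (x n)) <= A_bound.
Proof.
have [xsC _] := xsVI.
have := ler_enormD (A (x n) - A xs) (A xs); rewrite subrK.
have := A_lip _ _ (iterate_sublevel n) xsC.
have := ler_wpM2l (ltW L_gt0) (fejer_monotone _ xsVI _ _ (leq0n n)).
by rewrite /A_bound; lra.
Qed.

Lemma lam_Ax_le n : lam n * enorm (A (x n)) <= sigma * A_bound.
Proof.
by rewrite ler_pM ?enorm_ge0 ?enorm_Ax_le ?(ltW (lam_gt0 n)) ?step_size_le.
Qed.

Lemma enorm_Ay_le n : enorm (A (y n)) <= A_bound + L * (sigma * A_bound).
Proof.
have [nu ky] := kkt_y n.
have [yx _] := kkt_dist _ _ _ _ _ _ (ltW Lf_gt0) (iterate_sublevel n) ky.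
rewrite addrAC subrr add0r enormN enormZ (gtr0_norm (lam_gt0 n)) in yx.
have := ler_enormD (A (y n) - A (x n)) (A (x n)); rewrite subrK.
have := A_lip _ _ (trial_sublevel n) (iterate_sublevel n).
have := ler_wpM2l (ltW L_gt0) (le_trans yx (lam_Ax_le n)).
by have := enorm_Ax_le n; lra.
Qed.

Definition slater_dist := enorm (xh - xs) + enorm (x 0%N - xs).

Lemma enorm_slater_le n : enorm (xh - x n) <= slater_dist.
Proof.
have := ler_enorm_dist xs xh (x n); rewrite (enormB xs (x n)).
by have := fejer_monotone _ xsVI _ _ (leq0n n); rewrite /slater_dist; lra.
Qed.

(** The bound of [kkt_multiplier_le], where [T] limits the displacement before projection. *)
Definition multiplier_bound (T : R) :=
  T * (slater_dist + T) / slater_gap Lf (- f xh) slater_dist.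

Lemma kkt_run_multiplier_le n z p nu T : kkt f Lf (x n) z p nu ->
  enorm (z - x n) <= T -> nu <= multiplier_bound T.
Proof.
move=> h zT; apply: (kkt_multiplier_le f Lf df f_convex Lf_gt0 (x n) z p nu xh) => //.
- exact: iterate_sublevel.
- by rewrite oppr_gt0.
- by rewrite opprK.
- exact: enorm_slater_le.
Qed.

Lemma iterate_decrease : exists2 kappa, 0 < kappa &
  forall n, enorm (x n.+1 - xs) ^+ 2 <=
    enorm (x n - xs) ^+ 2 - kappa * enorm (x n - y n) ^+ 2.
Proof.
have /andP[g0 g2] := gamma02; have /andP[m0 m1] := mu01.
(* Bounds the displacement of the second step, using [lam n <= sigma], [rho_bounds] and
   [enorm_Ay_le]. *)
pose T := gamma * sigma * (1 - mu)^-1 * (A_bound + L * (sigma * A_bound)).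
pose Q := 1 + multiplier_bound T * Lf.
have nule n nu : kkt f Lf (x n)
    (x n - (gamma * lam n * rho A (x n) (y n) (lam n)) *: A (y n)) (x n.+1) nu ->
    nu <= multiplier_bound T.
  move=> kp; apply: kkt_run_multiplier_le kp _.
  rewrite addrAC subrr add0r enormN enormZ.
  have [_ _ xy _] := run n.
  have [r0 r1 _] := rho_bounds A _ _ _ _ (ltW (lam_gt0 n)) mu01 xy (lam_accepts n).
  have l0 := ltW (lam_gt0 n).
  have gl0 := mulr_ge0 (ltW g0) l0.
  rewrite (ger0_norm (mulr_ge0 gl0 r0)).
  apply: ler_pM (mulr_ge0 gl0 r0) (enorm_ge0 _) _ (enorm_Ay_le n).
  apply: ler_pM gl0 r0 _ r1.
  by rewrite ler_wpM2l ?(ltW g0)//; exact: step_size_le.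
(* [multiplier_bound T] is nonnegative because it dominates an actual multiplier. *)
have Q0 : 0 < Q.
  have [nu kp] := kkt_x 0; have [nu0 _ _ _] := kp.
  rewrite ltr_pwDl// mulr_ge0 ?(ltW Lf_gt0)//.
  exact: le_trans (nule _ _ kp).
exists (gamma * (2 - gamma) * ((1 - mu) / (1 + mu)) ^+ 2 / Q).
  by rewrite divr_gt0// mulr_gt0 ?exprn_gt0 ?divr_gt0 ?mulr_gt0//; lra.
move=> n; have [nu kp] := kkt_x n.
rewrite -lerBlDl [in leRHS]mulrAC -[in leRHS]mulNr ler_pdivlMr// mulrC.
apply: le_trans (fejer_run _ _ _ xsVI kp).
(* The difference of squares is nonpositive, so enlarging its factor to [Q] only lowers the
   product. *)
apply: ler_wnM2r.
  by rewrite subr_le0 ler_sqr ?nnegrE ?enorm_ge0//; exact: fejer_monotone.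
by rewrite /Q lerD2l ler_wpM2r ?(ltW Lf_gt0)//; exact: nule kp.
Qed.

Lemma residual_cvg0 e : 0 < e ->
  exists N, forall n, (N <= n)%N -> enorm (x n - y n) < e.
Proof.
move=> e0; have [kappa k0 dec] := iterate_decrease.
have := @cvg_decrement0 _ (fun n => enorm (x n - xs) ^+ 2)
  (fun n => kappa * enorm (x n - y n) ^+ 2) (fun n => sqr_ge0 _)
  (fun n => mulr_ge0 (ltW k0) (sqr_ge0 _)) dec.
move=> /cvgrPdist_lt /(_ (kappa * e ^+ 2) (mulr_gt0 k0 (exprn_gt0 2 e0))).
move=> [N _ hN].
exists N => n /hN /=.
rewrite sub0r normrN (ger0_norm (mulr_ge0 (ltW k0) (sqr_ge0 _))).
by rewrite ltr_pM2l// ltr_sqr ?nnegrE ?enorm_ge0// ltW.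
Qed.

(** Divide [kkt_vi_gap] by the step: bounded multipliers and [lam_ge] make the constant independent
    of [n]. *)
Lemma iterate_vi_gap w : sublevel0 f w ->
  exists2 K, 0 <= K &
    forall n, - (K * enorm (x n - y n)) <= dotv (A (x n)) (w - x n).
Proof.
move=> wC.
pose W := enorm (w - xs) + enorm (x 0%N - xs).
have wx n : enorm (w - x n) <= W.
  have := ler_enorm_dist xs w (x n); rewrite (enormB xs (x n)).
  by have := fejer_monotone _ xsVI _ _ (leq0n n); rewrite /W; lra.
pose B := (1 + multiplier_bound (sigma * A_bound) * Lf) * W + sigma * A_bound.
have l0 : 0 < Num.min sigma (mu * delta / L).
  have /andP[m0 _] := mu01; have /andP[d0 _] := delta01.
  by rewrite lt_min sigma_gt0 divr_gt0 ?mulr_gt0.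
have hB n : - (enorm (x n - y n) * B) <= lam n * dotv (A (x n)) (w - x n) /\ 0 <= B.
  have [nu ky] := kkt_y n; have [nu0 _ _ _] := ky.
  have nule : nu <= multiplier_bound (sigma * A_bound).
    apply: kkt_run_multiplier_le ky _.
    by rewrite addrAC subrr add0r enormN enormZ (gtr0_norm (lam_gt0 n)) lam_Ax_le.
  have n1 : 0 <= 1 + nu * Lf by rewrite addr_ge0// mulr_ge0// ltW.
  have le1 : (1 + nu * Lf) * enorm (w - x n) + lam n * enorm (A (x n)) <= B.
    rewrite lerD ?lam_Ax_le// ler_pM ?enorm_ge0//.
    by rewrite lerD2l ler_wpM2r// ltW.
  split; last first.
    apply: le_trans le1; apply: addr_ge0; first exact: mulr_ge0 n1 (enorm_ge0 _).
    exact: mulr_ge0 (ltW (lam_gt0 n)) (enorm_ge0 _).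
  apply: le_trans (kkt_vi_gap f A Lf df f_convex Lf_gt0 _ _ w _ _ (lam_gt0 n) ky wC).
  by rewrite lerN2 ler_wpM2l ?enorm_ge0.
have [_ B0] := hB 0%N.
exists (B / Num.min sigma (mu * delta / L)); first by rewrite divr_ge0// ltW.
move=> n; have [h _] := hB n; have ln := lam_ge n.
rewrite -(ler_pM2l (lam_gt0 n)); apply: le_trans h.
rewrite mulrN lerN2 mulrA [enorm _ * B]mulrC ler_wpM2r ?enorm_ge0//.
by rewrite mulrA ler_pdivlMr// mulrC ler_wpM2r.
Qed.

Lemma cluster_point_VI p :
  (forall e N, 0 < e -> exists2 n, (N <= n)%N & enorm (x n - p) < e) ->
  VI (sublevel0 f) A p.
Proof.
move=> xp.
have pC : sublevel0 f p.
  (* If [f p > 0], continuity would give [f (x n) > 0] at an iterate close to [p]. *)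
  rewrite /sublevel0/= leNgt; apply/negP => fp.
  have /cvgrPdist_lt/(_ _ fp)/nbhs_ballP[e /= e0 he] := differentiable_continuous (df p).
  have [n _ xn] := xp e 0%N e0.
  have := he (x n); rewrite -ball_normE/= => /(_ _).
  rewrite distrC => /(_ (le_lt_trans (norm_le_enorm _) xn)) /ltr_normlW.
  by have := iterate_sublevel n; rewrite /sublevel0/=; lra.
split=> // w wC; have [K K0 gap] := iterate_vi_gap w wC.
pose W := enorm (w - p) + 1.
(* Collects the coefficients of three errors, each linear in [e]: the gap at [x n], the change of
   [A] and the change of base point. Then [e * S] stays below the supposed violation. *)
pose S := K + L * W + enorm (A p).
have S0 : 0 <= S by rewrite !addr_ge0 ?mulr_ge0 ?addr_ge0 ?enorm_ge0// ltW.
rewrite leNgt; apply/negP => neg.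
pose e := Num.min 1 (- dotv (A p) (w - p) / (S + 1)).
have e0 : 0 < e by rewrite lt_min ltr01 divr_gt0 ?oppr_gt0// ltr_wpDl.
have [N hN] := residual_cvg0 _ e0.
have [n Nn xn] := xp e N e0.
have yn := hN n Nn.
have eS : e * (S + 1) <= - dotv (A p) (w - p).
  by rewrite -ler_pdivlMr ?ltr_wpDl// ge_min lexx orbT.
have e1 : e <= 1 by rewrite ge_min lexx.
have wxn : enorm (w - x n) <= W.
  by have := ler_enorm_dist p w (x n); rewrite (enormB p (x n)) /W; lra.
have := A_lip _ _ pC (iterate_sublevel n); rewrite (enormB p) => lipn.
have c1 := ler_dotvN (A p - A (x n)) (w - x n).
have c2 := ler_dotvN (A p) (x n - p).
have id : dotv (A p) (w - p) = dotv (A (x n)) (w - x n)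
    + dotv (A p - A (x n)) (w - x n) + dotv (A p) (x n - p).
  rewrite -dotvDl [A (x n) + _]addrC subrK -dotvDr; congr dotv.
  by rewrite addrA subrK.
have b1 : K * enorm (x n - y n) <= K * e by rewrite ler_wpM2l// ltW.
have b2 : enorm (A p - A (x n)) * enorm (w - x n) <= L * e * W.
  rewrite ler_pM ?enorm_ge0//; apply: le_trans lipn _.
  by rewrite ler_wpM2l// ltW.
have b3 : enorm (A p) * enorm (x n - p) <= enorm (A p) * e.
  by rewrite ler_wpM2l ?enorm_ge0// ltW.
by have := gap n; move: id b1 b2 b3 eS c1 c2; rewrite /S; lra.
Qed.

Lemma run_cvg_VI : exists2 p, VI (sublevel0 f) A p & x n @[n --> \oo] --> p.
Proof.
have [|p xp] := @bounded_seq_cluster R d x (enorm (x 0%N - xs) + enorm xs).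
  move=> n; have := ler_enormD (x n - xs) xs; rewrite subrK.
  by have := fejer_monotone _ xsVI _ _ (leq0n n); lra.
have pVI := cluster_point_VI p xp.
exists p => //; apply: enorm_cvg => e e0.
(* One iterate close to [p] suffices: the distance to the solution [p] never increases
   afterwards. *)
have [N _ xN] := xp e 0%N e0; exists N => n Nn.
exact: le_lt_trans (fejer_monotone _ pVI _ _ Nn) xN.
Qed.

End Bounds.
End Run.

Theorem theorem3p2 (R : realType) (d : nat)
    (f : 'rV[R]_d -> R) (A : 'rV[R]_d -> 'rV[R]_d) (Lf L : R)
    (f_C1 : continuously_differentiable f)
    (f_convex : convex_function [set: convex_lmodType 'rV[R]_d] f)
    (Lf_gt0 : 0 < Lf)
    (grad_lip : elipschitz_on [set: 'rV[R]_d] Lf (grad f))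
    (A_pm : pseudo_monotone_on (sublevel0 f) A)
    (L_gt0 : 0 < L)
    (A_lip : elipschitz_on (sublevel0 f) L A)
    (VI_neq0 : VI (sublevel0 f) A !=set0)
    (slater : exists xhat : 'rV[R]_d, f xhat < 0)
    (mu delta sigma gamma : R)
    (mu01 : 0 < mu < 1) (delta01 : 0 < delta < 1)
    (sigma_gt0 : 0 < sigma) (gamma02 : 0 < gamma < 2)
    (x1 : 'rV[R]_d) (x1C : sublevel0 f x1)
    (x : nat -> 'rV[R]_d)
    (x_run : moving_ball_run f Lf A mu delta sigma gamma x1 x) :
  exists2 xs : 'rV[R]_d, VI (sublevel0 f) A xs & x n @[n --> \oo] --> xs.
Proof.
have [df _] := f_C1; have [xh fxh] := slater; have [xs xsVI] := VI_neq0.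
have [x0E [k [y run]]] := x_run.
rewrite -x0E in x1C.
exact: (@run_cvg_VI _ _ f A Lf L df f_convex Lf_gt0 grad_lip A_pm L_gt0 A_lip
  xh fxh mu delta sigma gamma mu01 delta01 sigma_gt0 gamma02 x y k x1C run xs xsVI).
Qed.
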